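(* For every $\gamma\ge 0$ there exists a $\gamma$-resettable scheduling problem such that the competitive ratio of the randomized algorithm that chooses $\omega$ uniformly at random from $(-1,0]$ and runs $\textsc{Mimic}(\gamma,\omega)$ is at least $1+(1+\gamma)/\ln(2+\gamma)$.
   Context: \textbf{$\gamma$-resettable scheduling.} Jobs are handled by an executor that has a set of states, one of which is a distinguished initial state; the executor is in the initial state at time $0$. An input $\mathcal{I}$ is a sequence (also viewed as a set) of jobs released over time; each job $r$ has an arrival time $a(r)$, a weight $w(r)\ge 0$, and possibly other parameters determining its execution. A job cannot be started before its arrival time. $C_{A}(r)$ denotes the completion time of job $r$ under a schedule/algorithm $A$, and the cost is $\mathrm{cost}_A(\mathcal{I})=\sum_{r\in\mathcal{I}} w(r) C_A(r)$. For a time $\tau$, $\mathcal{I}_\tau$ is the set of jobs arriving by time $\tau$. An auxiliary $\tau$-schedule is a problem-specific feasible way of executing a subset of jobs of $\mathcal{I}_\tau$ that starts at time $0$, terminates at time $\tau$, and leaves no job partially executed; $R(A)$ denotes the set of jobs completed by a $\tau$-schedule $A$ when run from time $0$. The problem is $\gamma$-resettable if: (Delayed execution) whenever the executor is in the initial state at a time $t$, it can execute any auxiliary $\tau$-schedule with $\tau\le t$ during $[t,t+\tau)$, and a job completed at time $z$ by the schedule run from time $0$ is now completed at time $t+z$ (unless already executed before); (Resetting) if the executor was in the initial state at time $t$ and executed a $\tau$-schedule ending at $t+\tau$, it can be returned to the initial state using extra time $\gamma\tau$; (Learning minimum) $\min(\mathcal{I})$, the earliest time at which an optimal offline solution may complete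 some job, satisfies $\min(\mathcal{I})>0$ and is learned by an online algorithm at or before time $\min(\mathcal{I})$. \textbf{Competitive ratio.} The competitive ratio of a randomized online algorithm is the infimum of all $c$ such that for every input $\mathcal{I}$ its expected cost is at most $c\cdot\mathrm{cost}_{\mathrm{OPT}}(\mathcal{I})$, where $\mathrm{OPT}$ is an optimal offline solution. \textbf{Auxiliary schedules $S_\tau$.} For a $\tau$-schedule $A$, $\mathrm{val}_\tau(A)=\sum_{r\in R(A)} w(r)C_A(r) + \tau\cdot w(\mathcal{I}_\tau\setminus R(A))$, where $w(R)=\sum_{r\in R}w(r)$. $S_\tau$ is a $\tau$-schedule minimizing $\mathrm{val}_\tau$, ties broken arbitrarily but deterministically. \textbf{Routine $\textsc{Mimic}(\gamma,\omega)$}, $\omega\in(-1,0]$: let $\alpha=2+\gamma$ and $\tau_k=\min(\mathcal{I})\cdot\alpha^{k+\omega}$. It does nothing until time $\tau_1$. For each $k\ge 1$, at time $\tau_k$ (when the executor is in the initial state) it computes $S_{\tau_k}$, executes it during $[\tau_k,2\tau_k)$ (without interruption or modification by later jobs), serving only those jobs of $S_{\tau_k}$ not served earlier, and then resets the executor in time $\gamma\tau_k$, so it is in the initial state at time $\alpha\tau_k=\tau_{k+1}$. *)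

(* Defs.v *)
From HB Require Import structures.
From mathcomp Require Import all_boot all_order all_algebra.
From mathcomp Require Import all_classical all_reals all_analysis.

Set Implicit Arguments.
Unset Strict Implicit.
Unset Printing Implicit Defensive.

Import Order.TTheory GRing.Theory Num.Theory.
Import numFieldNormedType.Exports.

Local Open Scope classical_set_scope.
Local Open Scope ring_scope.

(* A run of the executor over the whole time axis [0, +oo[.  Jobs are named by
   their position in the input sequence.  A job with a start time but no
   completion time is started and never finished. *)
Record execution (R : realType) (state : Type) := Execution {
  trajectory : R -> state;
  start : nat -> option R;
  compl : nat -> option R }.

(* [feasible I e] says that [e] is one of the possible runs of the executor on
   the input [I]; it need not execute all the jobs. *)
Record scheduling_problem (R : realType) := SchedulingProblem {
  job : Type;
  arrival : job -> R;
  weight : job -> R;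
  state : Type;
  init : state;
  feasible : seq job -> execution R state -> Prop;
  arrival_ge0 : forall r, 0 <= arrival r;
  weight_ge0 : forall r, 0 <= weight r;
  feasible_init : forall I e, feasible I e -> trajectory e 0 = init;
  feasible_start : forall I e i s, feasible I e -> start e i = Some s ->
    exists2 r, onth I i = Some r & arrival r <= s;
  feasible_compl : forall I e i c, feasible I e -> compl e i = Some c ->
    exists2 s, start e i = Some s & s <= c }.

Arguments arrival {R} P r : rename.
Arguments weight {R} P r : rename.
Arguments init {R} P : rename.
Arguments feasible {R} P I e : rename.

Section Problem.
Variables (R : realType) (P : scheduling_problem R).

Notation run := (execution R (state P)).
Implicit Types (I : seq (job P)) (e A : run) (t tau : R).

(* Listing the jobs by arrival makes [released I tau] a prefix of [I], so a job
   has the same position in both.  The empty input, of cost 0 and without a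
   min(I), is left out. *)
Definition is_input I : Prop :=
  (0 < size I)%N /\ sorted (fun r s => arrival P r <= arrival P s) I.

Definition released I tau : seq (job P) := [seq r <- I | arrival P r <= tau].

Definition done_by e t (i : nat) : bool :=
  if compl e i is Some c then c <= t else false.

Definition solution I e : Prop :=
  feasible P I e /\ forall i, (i < size I)%N -> compl e i.

Definition cost I e : R :=
  \sum_(i < size I) weight P (tnth (in_tuple I) i) * odflt 0 (compl e i).

Definition optimal I e : Prop :=
  solution I e /\ forall e', solution I e' -> cost I e <= cost I e'.

(* [m] is min(I). *)
Definition is_min I (m : R) : Prop :=
  (exists e, optimal I e /\ exists i, compl e i = Some m) /\
  (forall e i c, optimal I e -> compl e i = Some c -> m <= c).

(* A tau-schedule is a feasible run on the jobs arriving by [tau] in which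
   every job ever started is completed by [tau]; how the trajectory continues
   after [tau] is irrelevant. *)
Definition tau_schedule I tau A : Prop :=
  feasible P (released I tau) A /\
  forall i, start A i -> done_by A tau i.

Definition val_tau I tau A : R :=
  let J := released I tau in
  \sum_(i < size J | compl A i)
     weight P (tnth (in_tuple J) i) * odflt 0 (compl A i)
  + tau * \sum_(i < size J | ~~ compl A i) weight P (tnth (in_tuple J) i).

Definition val_minimal I tau A : Prop :=
  tau_schedule I tau A /\
  forall B, tau_schedule I tau B -> val_tau I tau A <= val_tau I tau B.

(* Facts taken for granted when speaking of OPT, of S_tau and of an algorithm
   that waits: optimal solutions and minimizers of [val_tau] exist, the
   executor may stay idle in its initial state, and the jobs which a run has
   completed by [tau] can be executed in the same way by a tau-schedule. *)
Definition well_posed : Prop :=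
  [/\ forall I, is_input I -> exists e, optimal I e,
      forall I tau, is_input I -> 0 <= tau -> exists A, val_minimal I tau A,
      forall I, is_input I -> exists2 e, feasible P I e &
        (forall t, 0 <= t -> trajectory e t = init P) /\
        (forall i, start e i = None) &
      forall I e tau, is_input I -> 0 <= tau -> feasible P I e ->
        exists2 A, tau_schedule I tau A &
          forall i, (done_by e tau i ->
                       start A i = start e i /\ compl A i = compl e i) /\
                    (~~ done_by e tau i -> compl A i = None)].

(* [e'] has the same past as [e] at time [t]. *)
Definition agree_until t e e' : Prop :=
  [/\ forall s, 0 <= s <= t -> trajectory e' s = trajectory e s,
      forall i, done_by e t i ->
        start e' i = start e i /\ compl e' i = compl e i &
      forall i c, compl e' i = Some c -> c < t -> compl e i = Some c].

(* During [t, t + tau[, [e] does what [A] does during [0, tau[, skipping the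
   jobs it has completed before, and nothing else. *)
Definition executes e t tau A : Prop :=
  forall i, ~~ done_by e t i ->
    (start A i -> start e i = omap (fun s => t + s) (start A i) /\
                  compl e i = omap (fun z => t + z) (compl A i)) /\
    (start A i = None ->
       (forall s, start e i = Some s -> ~~ (t <= s < t + tau)) /\
       (forall c, compl e i = Some c -> ~~ (t <= c < t + tau))).

Definition delayed_execution : Prop :=
  forall I e t tau A, is_input I -> feasible P I e -> 0 <= tau <= t ->
    trajectory e t = init P -> tau_schedule I tau A ->
    exists e', [/\ feasible P I e', agree_until t e e' & executes e' t tau A].

(* No job is completed on the way back to the initial state. *)
Definition resetting (gamma : R) : Prop :=
  forall I e t tau A, is_input I -> feasible P I e -> 0 <= t -> 0 <= tau ->
    trajectory e t = init P -> tau_schedule I tau A -> executes e t tau A ->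
    exists e', [/\ feasible P I e', agree_until (t + tau) e e',
      trajectory e' (t + tau + gamma * tau) = init P &
      forall i, done_by e' (t + tau + gamma * tau) i -> done_by e (t + tau) i].

(* At time [t] an online algorithm knows [t] and the jobs arrived by [t]; the
   learner [L] announces min(I) at some time [t <= min(I)] and is never
   wrong. *)
Definition learning_minimum : Prop :=
  exists L : R -> seq (job P) -> option R,
    forall I, is_input I -> exists m,
      [/\ is_min I m, 0 < m,
          forall t y, 0 <= t -> L t (released I t) = Some y -> y = m &
          exists t, 0 <= t <= m /\ L t (released I t) = Some m].

Definition resettable (gamma : R) : Prop :=
  [/\ delayed_execution, resetting gamma & learning_minimum].

(* A deterministic tie-breaking: S_tau is a function of [tau] and of the jobs
   arrived by [tau]. *)
Definition is_S (S : R -> seq (job P) -> run) : Prop :=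
  forall I tau, is_input I -> 0 <= tau ->
    val_minimal I tau (S tau (released I tau)).

Section Mimic.
Variables (gamma : R) (S : R -> seq (job P) -> run) (I : seq (job P)).
(* [m] is min(I). *)
Variables (m omega : R).

Definition mimic_tau (k : nat) : R := m * (2 + gamma) `^ (k%:R + omega).

Definition mimic_compl_S (k i : nat) : option R :=
  compl (S (mimic_tau k) (released I (mimic_tau k))) i.

(* Job [i] is served by the first S_(tau_k), k >= 1, that contains it, so the
   set below has at most one element; it is empty, and the completion time is
   +oo, when the job is never served. *)
Definition mimic_compl (i : nat) : \bar R :=
  ereal_inf [set x | exists k z,
    [/\ (1 <= k)%N, mimic_compl_S k i = Some z,
        forall j, (1 <= j < k)%N -> mimic_compl_S j i = None &
        x = (mimic_tau k + z)%:E]].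

Definition mimic_cost : \bar R :=
  (\sum_(i < size I) (weight P (tnth (in_tuple I) i))%:E * mimic_compl i)%E.

End Mimic.

(* The interval ]-1, 0] has length 1, so that Lebesgue measure on it is the
   uniform distribution. *)
Definition expected_mimic_cost (gamma : R) (S : R -> seq (job P) -> run)
    (I : seq (job P)) (m : R) : \bar R :=
  (\int[lebesgue_measure]_(omega in `](-1)%R, 0%R])
     mimic_cost gamma S I m omega)%E.

Definition competitive_ratio (gamma : R) (S : R -> seq (job P) -> run) :
    \bar R :=
  ereal_inf [set c%:E | c in [set c : R | forall I e m,
    is_input I -> optimal I e -> is_min I m ->
    (expected_mimic_cost gamma S I m <= c%:E * (cost I e)%:E)%E]].

End Problem.

(* Main.v *)
(* On a one-job input whose job needs time 1 and is available from the start,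
   OPT pays min(I) = 1, whereas Mimic completes nothing before tau_1 + 1 with
   tau_1 = alpha^(1 + omega), and the expectation of alpha^(1 + omega) for
   omega uniform in ]-1, 0] is (alpha - 1) / ln alpha.  So it is enough that all
   jobs are identical, of unit length, and executed independently of each other
   by an executor with a single state. *)
Require Import Defs.
From mathcomp Require Import all_boot all_order all_algebra.
From mathcomp Require Import all_classical all_reals all_analysis measurable_realfun.
From mathcomp Require Import ring lra.

Import Order.TTheory GRing.Theory Num.Theory.
Import numFieldNormedType.Exports.
Local Open Scope ring_scope.

(** The integral of a nonnegative function is the supremum over the simple functions below it, and
    those below [f] are below [g]. Measurability is avoided because the cost of Mimic depends on
    [omega] through an arbitrary [S]. *)
Lemma ge0_le_integral_nonmeasurable d (T : measurableType d) (R : realType)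
    (mu : {measure set T -> \bar R}) (D : set T) (f g : T -> \bar R) :
  (forall x, D x -> 0 <= f x)%E -> (forall x, D x -> f x <= g x)%E ->
  (\int[mu]_(x in D) f x <= \int[mu]_(x in D) g x)%E.
Proof.
move=> f0 fg.
have g0 x : D x -> (0 <= g x)%E by move=> Dx; exact: le_trans (f0 _ Dx) (fg _ Dx).
rewrite !ge0_integralE//; apply: le_ereal_sup => _ /= [h hf <-].
exists h => // x; apply: (le_trans (hf x)).
by apply: lee_restrict.
Qed.

Lemma integral_powR_obnd {R : realType} (a : R) : 1 < a ->
  (\int[lebesgue_measure]_(w in `](-1)%R, 0%R]) (a `^ (1 + w) + 1)%:E =
   ((a - 1) / ln a + 1)%:E)%E.
Proof.
move=> a1; have a0 : 0 < a by lra.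
have la : 0 < ln a by rewrite ln_gt0.
(* Writing the power as an exponential gives the antiderivative [F] explicitly. *)
pose f (w : R) := expR ((1 + w) * ln a) + 1.
pose F (w : R) : R := (ln a)^-1 * expR ((1 + w) * ln a) + w.
have dF (w : R) : is_derive w 1 F (f w).
  apply: is_derive_eq; rewrite /f /GRing.scale /=.
  by field; rewrite gt_eqF.
have cF (w : R) : {for w, continuous F}.
  by apply/differentiable_continuous/derivable1_diffP; exact: ex_derive.
have cf : continuous f.
  move=> w; apply: differentiable_continuous; apply/derivable1_diffP.
  exact: ex_derive.
transitivity (\int[lebesgue_measure]_(w in `](-1)%R, 0%R]) (f w)%:E)%E.
  by apply: eq_integral => w _; rewrite /f /powR gt_eqF.
rewrite integral_itv_obnd_cbnd; last first.
  apply/measurable_EFinP/measurable_funTS.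
  exact: continuous_measurable_fun.
rewrite (@continuous_FTC2 _ f F) //.
- rewrite -EFinB /F; congr (_%:E).
  rewrite (addr0 1) mul1r lnK ?posrE// subrr mul0r expR0.
  by field; rewrite gt_eqF.
- by apply: continuous_subspaceT.
- split; first by move=> w _; exact: ex_derive.
  + exact/cvg_at_right_filter/cF.
  + exact/cvg_at_left_filter/cF.
- by move=> w _; rewrite derive1E derive_val.
Qed.

Section UnitJobs.
Context {R : realType}.

(** Constraints are imposed job by job, so any number of jobs may overlap. With a single state, the
    trajectory is always initial. *)
Definition unit_feasible (I : seq unit) (e : execution R unit) : Prop :=
  forall i, compl e i = omap (fun s => s + 1) (start e i) /\
    forall s, start e i = Some s -> (i < size I)%N /\ 0 <= s.

Definition unit_jobs : scheduling_problem R.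
Proof.
refine (@SchedulingProblem R unit (fun=> 0) (fun=> 1) unit tt unit_feasible
  _ _ _ _ _) => //.
- by move=> _ e _; case: (trajectory e 0).
- move=> I e i s /(_ i)[_ /(_ s)] h /h[iI s0].
  by exists tt => //; move: iI; rewrite -onthTE; case: onth => // -[].
- move=> I e i c /(_ i)[-> _]; case: (start e i) => //= s [<-].
  by exists s => //; rewrite lerDl.
Defined.

Implicit Types (I : seq (job unit_jobs)) (e : execution R (state unit_jobs)).
Implicit Types S : R -> seq (job unit_jobs) -> execution R (state unit_jobs).

Lemma released_unit_jobs I (tau : R) : 0 <= tau -> released I tau = I.
Proof. by move=> tau0; apply/all_filterP/allP => r _. Qed.

Lemma unit_compl_ge1 {I e i c} :
  unit_feasible I e -> compl e i = Some c -> 1 <= c.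
Proof.
move=> /(_ i)[-> h]; case: (start e i) h => //= s /(_ s erefl)[_ s0] [<-].
by rewrite lerDr.
Qed.

Lemma cost_unit_jobs I e :
  cost I e = \sum_(i < size I) odflt 0 (compl e i).
Proof. by apply: eq_bigr => i _; rewrite mul1r. Qed.

(** Charging [tau] for an unfinished job amounts to a default completion time, so schedules can be
    compared job by job. *)
Lemma val_tau_unit_jobs I (tau : R) e : 0 <= tau ->
  val_tau I tau e = \sum_(i < size I) odflt tau (compl e i).
Proof.
move=> tau0; rewrite /val_tau released_unit_jobs// mulr_sumr.
rewrite [X in X + _]big_mkcond [X in _ + X]big_mkcond -big_split /=.
by apply: eq_bigr => i _; case: compl => [c|] /=; rewrite ?mul1r ?mulr1 ?addr0 ?add0r.
Qed.

Definition start_all_at0 I : execution R (state unit_jobs) :=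
  Execution (fun=> tt) (fun i => if (i < size I)%N then Some 0 else None)
    (fun i => if (i < size I)%N then Some 1 else None).

Lemma start_all_at0_feasible I : unit_feasible I (start_all_at0 I).
Proof.
by move=> i /=; case: ifP => //= iI; rewrite add0r; split => // s [<-].
Qed.

Lemma start_all_at0_optimal I : optimal I (start_all_at0 I).
Proof.
split; first by split; [exact: start_all_at0_feasible|move=> i /= ->].
move=> e [fe ce]; rewrite !cost_unit_jobs; apply: ler_sum => i _ /=.
rewrite ltn_ord /=; case E: (compl e i) (ce i (ltn_ord i)) => [c|]//= _.
exact: unit_compl_ge1 E.
Qed.

Definition idle : execution R (state unit_jobs) :=
  Execution (fun=> tt) (fun=> None) (fun=> None).

Lemma idle_feasible I : unit_feasible I idle.
Proof. by move=> i; split. Qed.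

(** Independence of the jobs allows the unfinished ones to be erased without disturbing the
    others. *)
Definition truncate e (t : R) : execution R (state unit_jobs) :=
  Execution (trajectory e)
    (fun i => if done_by e t i then start e i else None)
    (fun i => if done_by e t i then compl e i else None).

Lemma truncate_feasible I e t : unit_feasible I e -> unit_feasible I (truncate e t).
Proof. by move=> fe i /=; case: ifP => // _; exact: fe. Qed.

Lemma val_minimal_unit_jobs_exists I (tau : R) : 0 <= tau ->
  exists A, val_minimal I tau A.
Proof.
move=> tau0; have [tau1|tau1] := leP 1 tau.
  exists (start_all_at0 I); split.
    split; first by rewrite released_unit_jobs//; exact: start_all_at0_feasible.
    by move=> i; rewrite /done_by /=; case: ifP.
  move=> B [fB _]; rewrite !val_tau_unit_jobs//; apply: ler_sum => i _ /=.
  rewrite ltn_ord /=; case E: (compl B i) => [c|]//=.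
  exact: unit_compl_ge1 E.
(* For [tau < 1], finishing a job costs at least 1, more than the penalty [tau] for leaving it
   out. *)
exists idle; split.
  by split; first exact: idle_feasible.
move=> B [fB dB]; rewrite !val_tau_unit_jobs//; apply: ler_sum => i _ /=.
case E: (compl B i) => [c|]//=.
by rewrite (le_trans (ltW tau1))//; exact: unit_compl_ge1 E.
Qed.

Lemma unit_jobs_well_posed : well_posed unit_jobs.
Proof.
split.
- by move=> I _; exists (start_all_at0 I); exact: start_all_at0_optimal.
- by move=> I tau _; exact: val_minimal_unit_jobs_exists.
- by move=> I _; exists idle; first exact: idle_feasible.
- move=> I e tau _ tau0 fe; exists (truncate e tau).
    split; first by rewrite released_unit_jobs//; exact: truncate_feasible.
    by move=> i; rewrite {1}/done_by /=; case: ifP.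
  by move=> i; split => [/=->|/negbTE/= ->].
Qed.

Lemma unit_jobs_delayed_execution : delayed_execution unit_jobs.
Proof.
move=> I e t tau A _ fe /andP[tau0 taut] _ [].
rewrite released_unit_jobs// => fA dA.
(* Jobs done by [t] keep their past; all others drop their plan in [e] and follow [A] shifted by
   [t]. *)
pose e' : execution R (state unit_jobs) := Execution (trajectory e)
  (fun i => if done_by e t i then start e i else omap (fun s => t + s) (start A i))
  (fun i => if done_by e t i then compl e i else omap (fun z => t + z) (compl A i)).
have t0 : 0 <= t by exact: le_trans taut.
(* Shifted completions fall strictly after [t], so [e'] and [e] have the same jobs done by [t]. *)
have gt_t i c : compl A i = Some c -> t < t + c.
  by move=> /(unit_compl_ge1 fA) c1; rewrite ltrDl (lt_le_trans ltr01).
have de' i : done_by e' t i = done_by e t i.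
  rewrite [LHS]/done_by /=; case: ifPn => [|_]; first by rewrite /done_by.
  case E: (compl A i) => [c|]//=; apply/negbTE; rewrite -ltNge; exact: gt_t E.
exists e'; split.
- move=> i /=; case: ifP => _; first exact: fe.
  have [-> sA] := fA i; split; first by case: (start A i) => //= s; rewrite addrA.
  case: (start A i) sA => //= s /(_ s erefl)[iI s0] _ [<-].
  by split => //; exact: addr_ge0.
- split => // i; first by rewrite /= => ->.
  move=> c /=; case: ifP => // _; case E: (compl A i) => [z|]//= [<-].
  by move=> /(lt_trans (gt_t _ _ E)); rewrite ltxx.
- move=> i; rewrite de' => /negbTE nd /=; rewrite nd; split => // sA.
  by rewrite (fA i).1 sA.
Qed.

(** The state is always initial; truncation at [t + tau] ensures that nothing is completed during
    the reset. *)
Lemma unit_jobs_resetting (gamma : R) : resetting unit_jobs gamma.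
Proof.
move=> I e t tau A _ fe t0 tau0 _ _ _; exists (truncate e (t + tau)); split.
- exact: truncate_feasible.
- split => // i; first by rewrite /= => ->.
  by move=> c /=; case: ifP.
- by case: (trajectory _ _).
- by move=> i; rewrite {1}/done_by /=; case: ifP.
Qed.

Lemma unit_jobs_is_min I : (0 < size I)%N -> is_min I 1.
Proof.
move=> I0; split.
  exists (start_all_at0 I); split; first exact: start_all_at0_optimal.
  by exists 0%N; rewrite /= I0.
by move=> e i c [[fe _] _]; exact: unit_compl_ge1.
Qed.

Lemma unit_jobs_resettable (gamma : R) : resettable unit_jobs gamma.
Proof.
split; [exact: unit_jobs_delayed_execution|exact: unit_jobs_resetting|].
(* Every nonempty input has minimum 1, so the learner can announce 1 at time 0. *)
exists (fun _ _ => Some 1) => I [I0 _]; exists 1; split => //.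
- exact: unit_jobs_is_min.
- by move=> t y _ [].
- by exists 0; rewrite lexx ler01.
Qed.

(** A served job waits for some [tau_k >= tau_1] and then at least one unit more, however ties are
    broken; a job never served has completion time +oo. *)
Lemma unit_jobs_mimic_compl_ge (gamma omega : R) S I i : 0 <= gamma ->
  is_input I -> is_S S ->
  (((2 + gamma) `^ (1 + omega) + 1)%:E <= mimic_compl gamma S I 1 omega i)%E.
Proof.
move=> g0 inI hS; apply/ereal_infP => _ [k [z [k1 Sz _ ->]]].
have tau0 : 0 <= mimic_tau gamma 1 omega k by rewrite /mimic_tau mul1r powR_ge0.
have [[fS _] _] := hS I _ inI tau0.
rewrite lee_fin lerD//; last exact: unit_compl_ge1 Sz.
rewrite /mimic_tau mul1r ler_powR//; first by lra.
by rewrite lerD2r ler1n.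
Qed.

Lemma unit_jobs_competitive_ratio (gamma : R) S : 0 <= gamma -> is_S S ->
  ((1 + (1 + gamma) / ln (2 + gamma))%:E <= competitive_ratio gamma S)%E.
Proof.
move=> g0 hS; apply/ereal_infP => _ [c hc <-].
have inI : is_input ([:: tt] : seq (job unit_jobs)) by [].
apply: le_trans (_ : _ <= expected_mimic_cost gamma S [:: tt] 1)%E _.
  rewrite (_ : _%:E = \int[lebesgue_measure]_(w in `](-1)%R, 0%R])
    ((2 + gamma) `^ (1 + w) + 1)%:E)%E; last first.
    rewrite integral_powR_obnd; last lra.
    by rewrite (addrC _ 1); congr (1 + _ / _)%:E; lra.
  apply: ge0_le_integral_nonmeasurable => w _.
    by rewrite lee_fin addr_ge0// powR_ge0.
  by rewrite /mimic_cost big_ord1 mul1e; exact: unit_jobs_mimic_compl_ge.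
(* The optimum of the one-job input is 1, so [c] itself bounds the expected cost. *)
have := hc _ _ 1 inI (start_all_at0_optimal _) (unit_jobs_is_min [:: tt] isT).
by rewrite cost_unit_jobs big_ord1 mule1.
Qed.

End UnitJobs.

Theorem theorem15 (R : realType) (gamma : R) (hgamma : 0 <= gamma) :
  exists P : scheduling_problem R,
    well_posed P /\ resettable P gamma /\
    forall S : R -> seq (job P) -> execution R (state P), is_S S ->
      ((1 + (1 + gamma) / ln (2 + gamma))%:E <= competitive_ratio gamma S)%E.
Proof.
exists unit_jobs; split; first exact: unit_jobs_well_posed.
split; first exact: unit_jobs_resettable.
by move=> S; exact: unit_jobs_competitive_ratio.
Qed.
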